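(* For every $mS$-space $\langle X,\mathcal{K},R\rangle$, the set $\mathcal{V}_m(X)$ of monotone lower-Vietoris-type families, ordered by the restriction of $\le$, is a complete lattice which is dually isomorphic to the lattice of all congruences of the monotone semilattice $\langle\mathbf{S}(X),m_R\rangle$.
   Context: Topological spaces are pairs $\langle X,\mathcal{K}\rangle$ with $\mathcal{K}$ a subbase. $S(X)=\{U^c\colon U\in\mathcal{K}\}$, $C_\mathcal{K}(X)=\{\bigcap\mathcal{A}\colon\mathcal{A}\subseteq S(X)\}$. For $Y\subseteq X$, $\mathcal{Z}\subseteq S(X)$ is a $Y$-family if for all $A,B\in\mathcal{Z}$ there exist $H\in S(X)$, $C\in\mathcal{Z}$ with $Y\subseteq H$, $A\cap H\subseteq C$, $B\cap H\subseteq C$. An $S$-space is $\langle X,\mathcal{K}\rangle$ with: (S1) $T_0$ and $X=\bigcup\mathcal{K}$; (S2) $\mathcal{K}$ consists of compact open sets, closed under finite unions, $\emptyset\in\mathcal{K}$; (S3) for $U,V\in\mathcal{K}$, $x\in U\cap V$, there are $W,D\in\mathcal{K}$ with $x\notin W$, $x\in D$, $D\subseteq(U\cap V)\cup W$; (S4) if $Y\in C_\mathcal{K}(X)$ and $\mathcal{J}\subseteq S(X)$ is a $Y$-family with $Y\cap A^c\neq\emptyset$ for all $A\in\mathcal{J}$ then $Y\cap\bigcap\{A^c\colon A\in\mathcal{J}\}\ne\emptyset$. $\mathbf{S}(X)=\langle S(X),\cap,X\rangle$. $\mathcal{Z}(X)$ is the set of $Z=\bigcap\mathcal{L}$ with $\mathcal{L}\subseteq\mathcal{K}$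 dually directed. For $U\in S(X)$, $L_U=\{Z\in\mathcal{Z}(X)\colon Z\cap U\neq\emptyset\}$. An $mS$-space is $\langle X,\mathcal{K},R\rangle$ with $\langle X,\mathcal{K}\rangle$ an $S$-space and $R\subseteq X\times\mathcal{Z}(X)$ such that $m_R(U)=\{x\colon\forall Z\in R(x)[Z\cap U\ne\emptyset]\}\in S(X)$ for $U\in S(X)$ and $R(x)=\bigcap\{L_U\colon U\in S(X),x\in m_R(U)\}$. A congruence of $\langle\mathbf{S}(X),m_R\rangle$ is a semilattice congruence compatible with $m_R$. For a family $\mathcal{F}$ of subsets of $X$ and $U\subseteq X$, $U^-_\mathcal{F}=\{Y\in\mathcal{F}\colon Y\cap U\neq\emptyset\}$, $\mathcal{M}_\mathcal{F}=\{U^-_\mathcal{F}\colon U\in\mathcal{K}\}$. For $H\subseteq\mathcal{Z}(X)$, $[H\cap\mathcal{K})_\mathcal{F}=\{V\in\mathcal{K}\colon\exists U\in H\cap\mathcal{K}\,[U^-_\mathcal{F}\subseteq V^-_\mathcal{F}]\}$; $H$ is $\mathcal{M}_\mathcal{F}$-increasing if $[H\cap\mathcal{K})_\mathcal{F}=H\cap\mathcal{K}$. A monotone lower-Vietoris-type family is a family $\mathcal{F}$ of nonempty subbasic closed subsets such that $\langle\mathcal{F},\mathcal{M}_\mathcal{F}\rangle$ is an $S$-space and for every $Y\in\mathcal{F}$, $R[Y]=\{Z\in\mathcal{Z}(X)\colon\exists y\in Y\,[(y,Z)\in R]\}$ is $\mathcal{M}_\mathcal{F}$-increasing. The order: $\mathcal{F}_1\le\mathcal{F}_2$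 iff for all $U,V\in\mathcal{K}$, $U^-_{\mathcal{F}_2}=V^-_{\mathcal{F}_2}$ implies $U^-_{\mathcal{F}_1}=V^-_{\mathcal{F}_1}$.
   Formalization: Y-families in (S4) are required to be nonempty: with the empty family and Y = ∅ (which lies in C_K(X) because K covers X), (S4) as written would fail in every space, so no S-space would exist. *)

(* Defs.v *)
From HB Require Import structures.
From mathcomp Require Import all_boot.
From mathcomp Require Import boolp classical_sets functions.
From mathcomp Require Import topology.

Set Implicit Arguments.
Unset Strict Implicit.
Unset Printing Implicit Defensive.

Local Open Scope classical_set_scope.

Section OrderTheory.
Variables (P : Type) (le : P -> P -> Prop) (D : set P).

Record is_partial_order : Prop := {
  po_refl : forall x, D x -> le x x;
  po_trans : forall x y z, D x -> D y -> D z -> le x y -> le y z -> le x z;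
  po_anti : forall x y, D x -> D y -> le x y -> le y x -> x = y }.

Definition is_supremum (A : set P) (s : P) : Prop :=
  [/\ D s, forall a, A a -> le a s &
      forall u, D u -> (forall a, A a -> le a u) -> le s u].

Definition is_infimum (A : set P) (i : P) : Prop :=
  [/\ D i, forall a, A a -> le i a &
      forall l, D l -> (forall a, A a -> le l a) -> le l i].

Definition is_complete_lattice : Prop :=
  is_partial_order /\
  forall A : set P, A `<=` D ->
    (exists s, is_supremum A s) /\ (exists i, is_infimum A i).

End OrderTheory.

Definition dually_isomorphic (P Q : Type)
    (leP : P -> P -> Prop) (D : set P)
    (leQ : Q -> Q -> Prop) (E : set Q) : Prop :=
  exists f : P -> Q, set_bij D E f /\
    forall x y, D x -> D y -> (leP x y <-> leQ (f y) (f x)).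

(* The set T with the topology generated by the subbase K. *)
Definition subbase_space (T : choiceType) (K : set (set T)) : Type := T.

HB.instance Definition _ (T : choiceType) (K : set (set T)) :=
  Choice.on (subbase_space K).
HB.instance Definition _ (T : choiceType) (K : set (set T)) :=
  isSubBaseTopological.Build (subbase_space K) K id.

Section SSpace.
Variables (T : choiceType) (K : set (set T)).

Definition Sclosed : set (set T) := [set ~` U | U in K].

Definition subbasic_closed : set (set T) :=
  [set \bigcap_(A in AA) A | AA in [set AA : set (set T) | AA `<=` Sclosed]].

(* Nonemptiness has to be required: the empty set is always subbasic closed
   when the subbase covers the space, so axiom S4 below, applied to the empty
   family and Y = set0, could never hold. *)
Definition Y_family (Y : set T) (Z : set (set T)) : Prop :=
  [/\ Z !=set0, Z `<=` Sclosed &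
    forall A B, Z A -> Z B ->
      exists H C, [/\ Sclosed H, Z C, Y `<=` H, A `&` H `<=` C & B `&` H `<=` C]].

Record S_space : Prop := {
  S1_T0 : kolmogorov_space (subbase_space K);
  S1_cover : \bigcup_(U in K) U = setT;
  S2_compact : forall U, K U -> compact (U : set (subbase_space K));
  S2_open : forall U, K U -> open (U : set (subbase_space K));
  S2_setU : forall U V, K U -> K V -> K (U `|` V);
  S2_set0 : K set0;
  S3 : forall U V x, K U -> K V -> (U `&` V) x ->
    exists W D, [/\ K W, K D, ~ W x, D x & D `<=` (U `&` V) `|` W];
  S4 : forall Y J, subbasic_closed Y -> Y_family Y J ->
    (forall A, J A -> Y `&` ~` A !=set0) ->
    Y `&` \bigcap_(A in J) ~` A !=set0 }.

Definition dually_directed (L : set (set T)) : Prop :=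
  L !=set0 /\
  forall U V, L U -> L V -> exists W, [/\ L W, W `<=` U & W `<=` V].

Definition Zfam : set (set T) :=
  [set \bigcap_(U in L) U |
     L in [set L : set (set T) | L `<=` K /\ dually_directed L]].

Definition Lset (U : set T) : set (set T) :=
  [set Z | Zfam Z /\ Z `&` U !=set0].

End SSpace.

Section MSSpace.
Variables (T : choiceType) (K : set (set T)).
(* R x is the set R(x) = {Z | (x, Z) \in R}. *)
Variable (R : T -> set (set T)).

Definition mR (U : set T) : set T :=
  [set x | forall Z, R x Z -> Z `&` U !=set0].

(* Intersections of sets L_U are taken inside Zfam K: the intersection of the
   empty family is Zfam K. *)
Record mS_space : Prop := {
  mS_S_space : S_space K;
  mS_rel : forall x, R x `<=` Zfam K;
  mS_closed : forall U, Sclosed K U -> Sclosed K (mR U);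
  mS_eq : forall x, R x =
    Zfam K `&` \bigcap_(U in [set U | Sclosed K U /\ mR U x]) Lset K U }.

Record is_congruence (theta : set (set T * set T)) : Prop := {
  congr_sub : theta `<=` Sclosed K `*` Sclosed K;
  congr_refl : forall U, Sclosed K U -> theta (U, U);
  congr_sym : forall U V, theta (U, V) -> theta (V, U);
  congr_trans : forall U V W, theta (U, V) -> theta (V, W) -> theta (U, W);
  congr_meet : forall U1 V1 U2 V2, theta (U1, V1) -> theta (U2, V2) ->
    theta (U1 `&` U2, V1 `&` V2);
  congr_mR : forall U V, theta (U, V) -> theta (mR U, mR V) }.

Definition congruences : set (set (set T * set T)) := is_congruence.

(* The set of members of F that meet U; points of the space F are the elements
   of the subtype set_type F. *)
Definition hit (F : set (set T)) (U : set T) : set (set_type F) :=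
  [set Y : set_type F | val Y `&` U !=set0].
Arguments hit : clear implicits.

Definition hit_subbase (F : set (set T)) : set (set (set_type F)) :=
  [set hit F U | U in K].
Arguments hit_subbase : clear implicits.

Definition up_hit (F H : set (set T)) : set (set T) :=
  [set V | K V /\ exists U, (H `&` K) U /\ hit F U `<=` hit F V].

Definition hit_increasing (F H : set (set T)) : Prop :=
  up_hit F H = H `&` K.

Definition Rimage (Y : set T) : set (set T) :=
  [set Z | Zfam K Z /\ exists y, Y y /\ R y Z].

Record is_monotone_vietoris (F : set (set T)) : Prop := {
  mv_closed : forall Y, F Y -> subbasic_closed K Y /\ Y !=set0;
  mv_S_space : S_space (hit_subbase F);
  mv_increasing : forall Y, F Y -> hit_increasing F (Rimage Y) }.

Definition Vm : set (set (set T)) := is_monotone_vietoris.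

Definition vietoris_le (F1 F2 : set (set T)) : Prop :=
  forall U V, K U -> K V -> hit F2 U = hit F2 V -> hit F1 U = hit F1 V.

End MSSpace.

Arguments hit {T} F U.
Arguments hit_subbase {T} K F.

(* Main.v *)
Require Import Defs.
From mathcomp Require Import all_boot.
From mathcomp Require Import boolp classical_sets functions.
From mathcomp Require Import filter topology.

(** Write [theta F] for the pairs of subbasic closed sets that contain the same
    members of [F].  In the other direction, a congruence [theta] yields the
    intersections of the [theta]-saturated filters of S(X) that are irreducible,
    i.e. the dual S-space of the quotient S(X)/theta.  Zorn's lemma provides enough
    irreducible filters to separate non-congruent sets and to verify (S4) and
    compactness, while (S3) and (S4) for a given [F] say that the traces of its
    members are exactly the irreducible filters of S(X)/(theta F); so the two maps
    are inverse to each other.  They match monotone families with congruences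
    compatible with m_R because, for [U] in [K], [U] lies in [R[Y]] iff [Y] is not
    contained in m_R of the complement of [U].  The order condition holds by
    definition, and congruences are closed under intersections. *)

Set Implicit Arguments.
Unset Strict Implicit.
Unset Printing Implicit Defensive.

Local Open Scope classical_set_scope.

(** A supremum in [D] is the preimage of an infimum in [E], and an infimum in [D] is the supremum of
    the lower bounds; infima in [E] therefore suffice. *)
Lemma is_complete_lattice_dual_iso (P Q : Type)
    (leP : P -> P -> Prop) (D : set P) (E : set (set Q)) (f : P -> set Q) :
  set_bij D E f ->
  (forall x y, D x -> D y -> leP x y <-> f y `<=` f x) ->
  (forall B, B `<=` E -> exists i, is_infimum subset E B i) ->
  is_complete_lattice leP D.
Proof.
move=> [fE finj fsurj] fle infE.
have supD (A : set P) : A `<=` D -> exists s, is_supremum leP D A s.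
  move=> AD; have [|i [Ei ilb iglb]] := infE (f @` A).
    by move=> _ [x Ax <-]; exact/fE/AD.
  have [s Ds fsi] := fsurj _ Ei; exists s; split=> // [a Aa|u Du uub].
    by apply/fle; rewrite ?fsi; [exact: AD|exact: Ds|apply: ilb; exists a].
  apply/fle => //; rewrite fsi; apply: iglb; first exact: fE.
  by move=> _ [a Aa <-]; apply/fle; [exact: AD|exact: Du|exact: uub].
split; first split.
- by move=> x Dx; exact/fle.
- by move=> x y z Dx Dy Dz /fle xy /fle yz; apply/fle => //;
    exact: subset_trans (yz Dy Dz) (xy Dx Dy).
- move=> x y Dx Dy /fle xy /fle yx; apply: finj; rewrite ?inE //.
  by rewrite eqEsubset; split; [exact: yx|exact: xy].
move=> A AD; split; first exact: supD.
have [|i [Di ub lub]] := supD [set l | D l /\ forall a, A a -> leP l a].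
  by move=> l [].
exists i; split=> // [a Aa|l Dl llb]; last exact: ub.
by apply: lub => [|l [_]]; [exact: AD|exact].
Qed.

(** * Spaces generated by a subbase, and traces of closed sets on S(X) *)

Section Subbase.
Variables (T : choiceType) (K : set (set T)).
Implicit Types (A B U V Y : set T) (Q J : set (set T)).

Lemma subbase_open U : K U -> open (U : set (subbase_space K)).
Proof.
move=> KU; exists [set U]; last by rewrite bigcup_set1.
by move=> _ ->; exact: (@finI_from1 _ _ K id).
Qed.

(** Finite intersections of members of [K] form a base, and a filter is closed under finite
    intersections. *)
Lemma subbase_cvg (G : set_system (subbase_space K)) (x : subbase_space K) :
  Filter G -> (forall U, K U -> U x -> G U) -> G --> x.
Proof.
move=> FG GK A; rewrite nbhsE => -[B [[D DK <-] [C DC Cx]] BA].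
apply: (filterS (P := C)); first by move=> y Cy; apply: BA; exists C.
have [E EK CE] := DK _ DC; rewrite -CE in Cx *.
apply: filter_bigI => i iE; apply: GK; last exact: Cx.
by have /EK := iE; rewrite inE.
Qed.

(* Compactness turns a covering of [~` A] by the complements of a directed
   family into the inclusion of a single member in [A]. *)
Lemma bigcap_Sclosed_sub Q A : S_space K -> Q !=set0 -> Q `<=` Sclosed K ->
  (forall A B, Q A -> Q B -> Q (A `&` B)) -> Sclosed K A ->
  \bigcap_(B in Q) B `<=` A -> exists2 B, Q B & B `<=` A.
Proof.
move=> hS [C QC] QS QI [U KU <-] QU; apply: contrapT => noB.
have FQ : Filter (filter_from Q (fun B => B `&` U : set (subbase_space K))).
  apply: filter_from_filter; first by exists C.
  by move=> B D QB QD; exists (B `&` D); [exact: QI|move=> x [[]]].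
have PQ : ProperFilter (filter_from Q (fun B => B `&` U : set (subbase_space K))).
  apply: filter_from_proper => B QB; apply: contrapT => BU0.
  by apply: noB; exists B => // x Bx Ux; apply: BU0; exists x.
(* The cluster point [x] lies in every [B] of [Q]: otherwise the complement of [B] would be a
   neighbourhood of [x] missing [B]. *)
have [|x [Ux clx]] := S2_compact hS KU PQ; first by exists C => // x [].
apply: (QU x) => // B QB; have [V KV BE] := QS _ QB.
rewrite -BE => Vx; have [||y [[By _] Vy]] := clx (B `&` U) V.
- by exists B.
- by apply: open_nbhs_nbhs; split => //; exact: subbase_open.
- by move: By; rewrite -BE; exact.
Qed.

Lemma Sclosed_setC U : K U -> Sclosed K (~` U).
Proof. by exists U. Qed.

Lemma SclosedC A : Sclosed K A -> K (~` A).
Proof. by move=> [U KU <-]; rewrite setCK. Qed.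

(** The trace of [Y] on S(X), which stands for [Y] as a filter; a subbasic closed set is recovered
    from it by intersection. *)
Definition enclosing Y : set (set T) := [set A | Sclosed K A /\ Y `<=` A].

Lemma bigcap_enclosing Y : subbasic_closed K Y -> \bigcap_(A in enclosing Y) A = Y.
Proof.
move=> [AA AAS <-]; rewrite eqEsubset; split=> [x Ax A AAA|x Yx A [_]]; last exact.
by apply: Ax; split; [exact: AAS|move=> y; exact].
Qed.

Lemma enclosing_inj Y Y' : subbasic_closed K Y -> subbasic_closed K Y' ->
  enclosing Y = enclosing Y' -> Y = Y'.
Proof. by move=> cY cY' YY'; rewrite -(bigcap_enclosing cY) YY' bigcap_enclosing. Qed.

Lemma subbasic_closed_bigcap Q : Q `<=` Sclosed K ->
  subbasic_closed K (\bigcap_(A in Q) A).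
Proof. by exists Q. Qed.

Lemma hitC (F : set (set T)) A (Y : set_type F) :
  hit F (~` A) Y <-> ~ (val Y `<=` A).
Proof.
split=> [[x [Yx nAx]] YA|YA]; first exact/nAx/YA.
by apply: contrapT => h; apply: YA => x Yx; apply: contrapT => nAx; apply: h; exists x.
Qed.

Lemma hitNC (F : set (set T)) U (Y : set_type F) :
  hit F U Y <-> ~ (val Y `<=` ~` U).
Proof. by rewrite -[X in hit F X]setCK; exact: hitC. Qed.

End Subbase.

(** * Congruences of S(X) and the filters of their quotients *)

Section SemilatticeCongruence.
Variables (T : choiceType) (K : set (set T)) (R : T -> set (set T)).
Hypothesis hS : S_space K.
Implicit Types (A B C U V Y : set T) (Q J G : set (set T)).

Lemma SclosedT : Sclosed K setT.
Proof. by exists set0; [exact: (S2_set0 hS)|rewrite setC0]. Qed.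

Lemma SclosedI A B : Sclosed K A -> Sclosed K B -> Sclosed K (A `&` B).
Proof.
move=> [U KU <-] [V KV <-].
by exists (U `|` V); [exact: (S2_setU hS)|rewrite setCU].
Qed.

Variable theta : set (set T * set T).
Hypothesis cth : is_congruence K R theta.

(** The meet order of the quotient by [theta], pulled back to S(X). *)
Definition congr_le A B :=
  [/\ Sclosed K A, Sclosed K B & theta (A `&` B, A)].

Lemma congr_le_refl A : Sclosed K A -> congr_le A A.
Proof. by move=> SA; split=> //; rewrite setIid; exact: (congr_refl cth). Qed.

Lemma subset_congr_le A B : Sclosed K A -> Sclosed K B -> A `<=` B -> congr_le A B.
Proof. by move=> SA SB AB; split=> //; rewrite setIidl //; exact: (congr_refl cth). Qed.

Lemma congr_le_trans B A C : congr_le A B -> congr_le B C -> congr_le A C.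
Proof.
move=> [SA SB AB] [_ SC BC]; split=> //.
have h1 := congr_meet cth AB (congr_refl cth SC).
have h2 := congr_meet cth (congr_refl cth SA) BC.
apply: (congr_trans cth (congr_sym cth h1)); rewrite -setIA.
exact: (congr_trans cth h2 AB).
Qed.

Lemma congr_leI A B C : congr_le A B -> congr_le A C -> congr_le A (B `&` C).
Proof.
move=> [SA SB AB] [_ SC AC]; split=> //; first exact: SclosedI.
by have := congr_meet cth AB AC; rewrite setIACA setIid.
Qed.

Lemma congr_leIl A B : Sclosed K A -> Sclosed K B -> congr_le (A `&` B) A.
Proof. by move=> SA SB; apply: subset_congr_le => //; exact: SclosedI. Qed.

Lemma congr_leIr A B : Sclosed K A -> Sclosed K B -> congr_le (A `&` B) B.
Proof. by move=> SA SB; apply: subset_congr_le => //; exact: SclosedI. Qed.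

Lemma congr_leII A B C D :
  congr_le A B -> congr_le C D -> congr_le (A `&` C) (B `&` D).
Proof.
move=> AB CD; have [[SA _ _] [SC _ _]] := (AB, CD).
apply: congr_leI; first exact: congr_le_trans (congr_leIl SA SC) AB.
exact: congr_le_trans (congr_leIr SA SC) CD.
Qed.

Lemma congr_le_anti A B : congr_le A B -> congr_le B A -> theta (A, B).
Proof.
move=> [_ _ AB] [_ _]; rewrite setIC; apply: (congr_trans cth).
exact: (congr_sym cth).
Qed.

Lemma congr_leP A B : theta (A, B) -> congr_le A B.
Proof.
move=> AB; have [/= SA SB] := congr_sub cth AB; split=> //.
have := congr_meet cth (congr_refl cth SA) (congr_sym cth AB).
by rewrite setIid.
Qed.

(** Closure under [congr_le] saturates [Q] for [theta], so these are the preimages of the filters of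
    the quotient. *)
Record is_congr_filter Q : Prop := {
  congr_filter_sub : Q `<=` Sclosed K;
  congr_filterT : Q setT;
  congr_filterI : forall A B, Q A -> Q B -> Q (A `&` B);
  congr_filter_up : forall A B, Q A -> congr_le A B -> Q B }.

(* This first-order form is equivalent to meet-irreducibility of [Q] in the
   lattice of saturated filters, i.e. of filters of the quotient. *)
Record is_irreducible Q : Prop := {
  irr_filter : is_congr_filter Q;
  irr_proper : exists2 A, Sclosed K A & ~ Q A;
  irr_split : forall A B, Sclosed K A -> Sclosed K B -> ~ Q A -> ~ Q B ->
    exists H C, [/\ Q H, Sclosed K C, ~ Q C,
      congr_le (A `&` H) C & congr_le (B `&` H) C] }.

Definition adjoin Q A : set (set T) :=
  [set B | exists2 H, Q H & congr_le (A `&` H) B].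

Lemma adjoin_congr_filter Q A : is_congr_filter Q -> Sclosed K A -> is_congr_filter (adjoin Q A).
Proof.
move=> fQ SA; split.
- by move=> B [H _ []].
- exists setT; first exact: congr_filterT.
  by apply: congr_leIr => //; exact: SclosedT.
- move=> B C [H QH HB] [H' QH' HC]; exists (H `&` H'); first exact: congr_filterI.
  by rewrite -[A in A `&` (_ `&` _)]setIid setIACA; exact: congr_leII.
- by move=> B C [H QH HB] BC; exists H => //; exact: congr_le_trans HB BC.
Qed.

Lemma sub_adjoin Q A : is_congr_filter Q -> Sclosed K A -> Q `<=` adjoin Q A.
Proof.
by move=> fQ SA B QB; exists B => //; apply: congr_leIr => //; exact: congr_filter_sub QB.
Qed.

Lemma adjoin_self Q A : is_congr_filter Q -> Sclosed K A -> adjoin Q A A.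
Proof.
move=> fQ SA; exists setT; first exact: congr_filterT.
by apply: congr_leIl => //; exact: SclosedT.
Qed.

(** The condition on [J] is the algebraic form of a Y-family, with [G] in the place of Y. A filter
    maximal among those containing [G] and missing [J] is irreducible. *)
Lemma irreducible_extension G J : is_congr_filter G -> J !=set0 -> J `<=` Sclosed K ->
  (forall A B, J A -> J B -> exists H C,
    [/\ G H, J C, congr_le (A `&` H) C & congr_le (B `&` H) C]) ->
  (forall A, J A -> ~ G A) ->
  exists Q, [/\ is_irreducible Q, G `<=` Q & forall A, J A -> ~ Q A].
Proof.
move=> fG J0 JS JG JnG.
(* The union with [G] makes [P] true of the empty set, which is the union of the empty chain. *)
pose P X := is_congr_filter (X `|` G) /\ forall A, J A -> ~ (X `|` G) A.
have [|M [[fM MJ] Mmax]] := @Zorn_bigcup _ P.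
  move=> F FP Ftot; split.
    split.
    - by move=> A [[X /FP[fX _] XA]|/(congr_filter_sub fG)//]; apply: (congr_filter_sub fX); left.
    - by right; exact: congr_filterT.
    - move=> A B [[X FX XA]|GA] [[X' FX' XB]|GB].
      + have [XX'|X'X] := Ftot _ _ FX FX'.
          have [fX' _] := FP _ FX'.
          have [] := congr_filterI fX' (or_introl (XX' _ XA)) (or_introl XB).
            by left; exists X'.
          by right.
        have [fX _] := FP _ FX.
        have [] := congr_filterI fX (or_introl XA) (or_introl (X'X _ XB)).
          by left; exists X.
        by right.
      + have [fX _] := FP _ FX.
        by have [] := congr_filterI fX (or_introl XA) (or_intror GB); [left; exists X|right].
      + have [fX _] := FP _ FX'.
        by have [] := congr_filterI fX (or_intror GA) (or_introl XB); [left; exists X'|right].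
      + by right; exact: congr_filterI.
    - move=> A B [[X FX XA]|GA] AB; last by right; exact: (congr_filter_up fG GA AB).
      have [fX _] := FP _ FX.
      by have [] := congr_filter_up fX (or_introl XA) AB; [left; exists X|right].
  by move=> A JA [[X /FP[_ XJ] XA]|]; [apply: (XJ _ JA); left|exact: JnG].
set Q := M `|` G in fM MJ; exists Q.
(* By maximality, enlarging [Q] by any outside [A] produces a member of [J]. *)
have maxQ A : Sclosed K A -> ~ Q A -> exists2 B, J B & adjoin Q A B.
  move=> SA nQA; apply: contrapT => noB.
  have QA := sub_adjoin fM SA.
  apply: (Mmax (adjoin Q A)).
    split; first by apply: subset_trans QA; left.
    by move=> AM; apply: nQA; left; apply: AM; exact: adjoin_self.
  have -> : P (adjoin Q A) = (is_congr_filter (adjoin Q A) /\ forall B, J B -> ~ adjoin Q A B).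
    by rewrite /P setUidl //; apply: subset_trans QA; right.
  by split; [exact: adjoin_congr_filter|move=> B JB QAB; apply: noB; exists B].
split=> //; last by right.
split=> //; first by have [A JA] := J0; exists A; [exact: JS|exact: MJ].
move=> A B SA SB nQA nQB.
have [[A' JA' [H QH HA]] [B' JB' [H' QH' HB]]] := (maxQ _ SA nQA, maxQ _ SB nQB).
have [L [C [GL JC AC BC]]] := JG _ _ JA' JB'.
have [SH SH' SL] := And3 (congr_filter_sub fM QH) (congr_filter_sub fM QH') (congr_filter_sub fG GL).
(* [H] brings [A] below [A'], [H'] brings [B] below [B'], and [L] brings both [A'] and [B'] below
   [C], which lies in [J] and hence outside [Q]. *)
exists ((H `&` H') `&` L), C; split=> //.
- by apply: congr_filterI; [|exact: congr_filterI|right].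
- exact: JS.
- exact: MJ.
- apply: congr_le_trans AC; rewrite setIA; apply: congr_leII; last exact: congr_le_refl.
  apply: congr_le_trans HA; apply: congr_leII; [exact: congr_le_refl|exact: congr_leIl].
- apply: congr_le_trans BC; rewrite setIA; apply: congr_leII; last exact: congr_le_refl.
  apply: congr_le_trans HB; apply: congr_leII; [exact: congr_le_refl|exact: congr_leIr].
Qed.

Lemma irreducible_avoid G A : is_congr_filter G -> Sclosed K A -> ~ G A ->
  exists Q, [/\ is_irreducible Q, G `<=` Q & ~ Q A].
Proof.
move=> fG SA nGA; have [||||Q [iQ GQ QA]] := @irreducible_extension G [set A] fG.
- by exists A.
- by move=> _ ->.
- move=> _ _ -> ->; exists setT, A; split=> //; first exact: congr_filterT.
    by apply: congr_leIl => //; exact: SclosedT.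
  by apply: congr_leIl => //; exact: SclosedT.
- by move=> _ ->.
- by exists Q; split=> //; exact: QA.
Qed.

Lemma principal_congr_filter A : Sclosed K A -> is_congr_filter (congr_le A).
Proof.
move=> SA; split.
- by move=> B [].
- by apply: subset_congr_le => //; exact: SclosedT.
- by move=> B C; exact: congr_leI.
- by move=> B C; exact: congr_le_trans.
Qed.

(** Otherwise the principal filter of [A] misses [B] and extends to an irreducible filter that still
    misses it. *)
Lemma irreducible_separation A B : Sclosed K A -> Sclosed K B ->
  (forall Q, is_irreducible Q -> Q A -> Q B) -> congr_le A B.
Proof.
move=> SA SB AB; apply: contrapT => nAB.
have [Q [iQ AQ QB]] := irreducible_avoid (principal_congr_filter SA) SB nAB.
by apply: QB; apply: AB => //; exact/AQ/congr_le_refl.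
Qed.

(** By compactness, a subbasic closed set containing the intersection already contains one member of
    [Q]; passing to intersections thus loses no information. *)
Lemma enclosing_bigcap Q : is_congr_filter Q -> enclosing K (\bigcap_(A in Q) A) = Q.
Proof.
move=> fQ; rewrite eqEsubset; split=> [A [SA QA]|A QA]; last first.
  by split; [exact: congr_filter_sub QA|move=> x; exact].
have [|B QB BA] := bigcap_Sclosed_sub hS _ (congr_filter_sub fQ) (congr_filterI fQ) SA QA.
  by exists setT; exact: congr_filterT.
by apply: (congr_filter_up fQ QB); apply: subset_congr_le => //; exact: congr_filter_sub QB.
Qed.

(** * The dual S-space of the quotient, realised by subbasic closed sets of X *)

Definition congr_family : set (set T) :=
  [set Y | subbasic_closed K Y /\ is_irreducible (enclosing K Y)].

Lemma congr_family_bigcap Q : is_irreducible Q -> congr_family (\bigcap_(A in Q) A).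
Proof.
move=> iQ; have fQ := irr_filter iQ; split; last by rewrite enclosing_bigcap.
exact/subbasic_closed_bigcap/congr_filter_sub.
Qed.

Lemma congr_familyP (Y : set_type congr_family) : congr_family (val Y).
Proof. exact: (set_valP Y). Qed.

Lemma hit_congr_family U (Y : set_type congr_family) : K U ->
  hit congr_family U Y <-> ~ enclosing K (val Y) (~` U).
Proof.
move=> KU; rewrite hitNC; split=> h; first by move=> [_ /h].
by move=> YU; apply: h; split=> //; exact: Sclosed_setC.
Qed.

Lemma congr_family_point Q : is_irreducible Q ->
  exists Y : set_type congr_family, enclosing K (val Y) = Q.
Proof.
move=> iQ; have FQ := congr_family_bigcap iQ.
exists (exist (fun Y => Y \in congr_family) _ (mem_set FQ)); exact/enclosing_bigcap/irr_filter.
Qed.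

(** A point meets [U] iff its filter omits the complement of [U], so this is separation by
    irreducible filters. *)
Lemma hit_congr_family_sub U V : K U -> K V ->
  hit congr_family U `<=` hit congr_family V <-> congr_le (~` V) (~` U).
Proof.
move=> KU KV; split=> [UV|VU Y].
  apply: irreducible_separation; [exact: Sclosed_setC|exact: Sclosed_setC|].
  move=> Q iQ; have [Y <-] := congr_family_point iQ.
  move=> YV; apply: contrapT => /(hit_congr_family Y KU) /UV.
  by move/(hit_congr_family Y KV).
move=> /(hit_congr_family Y KU) nU; apply/(hit_congr_family Y KV) => YV; apply: nU.
have [_ iY] := congr_familyP Y; exact: (congr_filter_up (irr_filter iY) YV VU).
Qed.

Lemma nhit_congr_family A (Y : set_type congr_family) : Sclosed K A ->
  (~` hit congr_family (~` A)) Y <-> enclosing K (val Y) A.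
Proof.
move=> SA; split=> [nh|YA].
  by apply: contrapT => nYA; apply: nh; apply/hit_congr_family;
    rewrite ?setCK //; exact: SclosedC.
by move/(hit_congr_family Y (SclosedC SA)); rewrite setCK; exact.
Qed.

(** Turns the inclusions in a Y-family of the dual space into the inequalities that
    [irreducible_extension] asks for. *)
Lemma nhit_congr_le A H C (F := congr_family) :
  Sclosed K A -> Sclosed K H -> Sclosed K C ->
  ~` hit F (~` A) `&` ~` hit F (~` H) `<=` ~` hit F (~` C) -> congr_le (A `&` H) C.
Proof.
move=> SA SH SC h; apply: irreducible_separation => //; first exact: SclosedI.
move=> Q iQ QAH; have [Y YQ] := congr_family_point iQ.
have fQ := irr_filter iQ; rewrite -YQ in fQ QAH *.
apply/nhit_congr_family => //; apply: h; split; apply/nhit_congr_family => //.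
  exact: (congr_filter_up fQ QAH (congr_leIl SA SH)).
exact: (congr_filter_up fQ QAH (congr_leIr SA SH)).
Qed.

Lemma congr_family_compact U : K U ->
  compact (hit congr_family U : set (subbase_space (hit_subbase K congr_family))).
Proof.
move=> KU; rewrite compact_ultra => G uG GU.
have pG : ProperFilter G := @ultra_proper _ _ uG.
(* [P] consists of the sets that contain [G]-almost every point. An irreducible filter extending [P]
   and omitting the complement of [U] is a limit of [G] in the hit set of [U]. *)
pose P := [set A | Sclosed K A /\ G (~` hit congr_family (~` A))].
have fP : is_congr_filter P.
  split.
  - by move=> A [].
  - split; first exact: SclosedT.
    apply: filterS filterT => Y _; apply/nhit_congr_family; first exact: SclosedT.
    by split; first exact: SclosedT.
  - move=> A B [SA GA] [SB GB]; have SAB := SclosedI SA SB; split=> //.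
    apply: filterS (filterI GA GB) => Y [/nhit_congr_family YA /nhit_congr_family YB].
    apply/nhit_congr_family => //; split=> // x Yx.
    by split; [exact: (YA SA).2|exact: (YB SB).2].
  - move=> A B [SA GA] AB; have [_ SB _] := AB; split=> //.
    apply: filterS GA => Y /nhit_congr_family YA; apply/nhit_congr_family => //.
    by have [_ iY] := congr_familyP Y; exact: (congr_filter_up (irr_filter iY) (YA SA) AB).
have [|Q [iQ PQ nQU]] := irreducible_avoid fP (Sclosed_setC KU).
  move=> [_]; rewrite setCK => GnU; apply: (filter_not_empty G).
  by apply: filterS (filterI GU GnU) => Y [].
have [Y YQ] := congr_family_point iQ; exists Y; split.
  by apply/hit_congr_family; rewrite ?YQ.
apply: subbase_cvg => _ [V KV <-] /(hit_congr_family Y KV); rewrite YQ => nQV.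
have [//|GnV] := in_ultra_setVsetC (hit congr_family V) uG.
by exfalso; apply/nQV/PQ; split; [exact: Sclosed_setC|rewrite setCK].
Qed.

(** A point is determined by its filter, which gives T0; properness gives the covering, [irr_split]
    gives (S3), and [irreducible_extension] gives (S4). *)
Lemma congr_family_S_space : S_space (hit_subbase K congr_family).
Proof.
split.
- move=> Y Y' neq.
  have [U KU [[h nh]|[h nh]]] : exists2 U, K U &
      (hit congr_family U Y /\ ~ hit congr_family U Y') \/
      (hit congr_family U Y' /\ ~ hit congr_family U Y).
    apply: contrapT => noU; move/eqP: neq; apply; apply: val_inj.
    have [cY _] := congr_familyP Y; have [cY' _] := congr_familyP Y'.
    apply: (enclosing_inj cY cY'); rewrite eqEsubset; split=> A YA; apply: contrapT => nYA;
      have SA := YA.1; apply: noU; exists (~` A).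
    + exact: SclosedC.
    + right; split; last exact/nhit_congr_family.
      by apply: contrapT => /(nhit_congr_family Y' SA).
    + exact: SclosedC.
    + left; split; last exact/nhit_congr_family.
      by apply: contrapT => /(nhit_congr_family Y SA).
  + exists (hit congr_family U); left; split; last by rewrite inE.
    by rewrite inE; apply: open_nbhs_nbhs; split=> //; apply: subbase_open; exists U.
  + exists (hit congr_family U); right; split; last by rewrite inE.
    by rewrite inE; apply: open_nbhs_nbhs; split=> //; apply: subbase_open; exists U.
- rewrite eqEsubset; split=> // Y _; have [_ iY] := congr_familyP Y.
  have [A SA nA] := irr_proper iY; exists (hit congr_family (~` A)).
    by exists (~` A) => //; exact: SclosedC.
  by apply: contrapT => /(nhit_congr_family Y SA).
- by move=> _ [U KU <-]; exact: congr_family_compact.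
- by move=> U; exact: subbase_open.
- move=> _ _ [U KU <-] [V KV <-]; exists (U `|` V); first exact: (S2_setU hS).
  rewrite predeqE => Y; split=> [[x [Yx [Ux|Vx]]]|[[x [Yx Ux]]|[x [Yx Vx]]]].
  + by left; exists x.
  + by right; exists x.
  + by exists x; split; last left.
  + by exists x; split; last right.
- by exists set0; [exact: (S2_set0 hS)|rewrite predeqE => Y; split=> // -[x []]].
- move=> _ _ Y [U KU <-] [V KV <-] [/(hit_congr_family Y KU) nU /(hit_congr_family Y KV) nV].
  have [_ iY] := congr_familyP Y.
  have [H [C [YH SC nC UC VC]]] := irr_split iY (Sclosed_setC KU) (Sclosed_setC KV) nU nV.
  have SH := YH.1.
  exists (hit congr_family (~` H)), (hit congr_family (~` C)); split.
  + by exists (~` H) => //; exact: SclosedC.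
  + by exists (~` C) => //; exact: SclosedC.
  + exact/nhit_congr_family.
  + by apply: contrapT => /(nhit_congr_family Y SC).
  + move=> Y' Y'C; apply: contrapT => nUVH.
    have Y'H : enclosing K (val Y') H.
      by apply/nhit_congr_family => // h; apply: nUVH; right.
    have [_ iY'] := congr_familyP Y'; have fY' := irr_filter iY'.
    suff : enclosing K (val Y') C by move/(nhit_congr_family Y' SC).
    have [YU|nYU] := pselect (enclosing K (val Y') (~` U)).
      exact: (congr_filter_up fY' (congr_filterI fY' YU Y'H) UC).
    have [YV|nYV] := pselect (enclosing K (val Y') (~` V)).
      exact: (congr_filter_up fY' (congr_filterI fY' YV Y'H) VC).
    by exfalso; apply: nUVH; left; split; apply/hit_congr_family.
- move=> _ J [AA AAS <-] [[A0 JA0] JS JY] Jne; set YY := \bigcap_(A in AA) A in JY Jne *.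
  (* (S4) is moved to S(X): [G] collects the sets containing every member of [YY], and [J'] those
     whose closed counterparts lie in [J]. An irreducible filter extending [G] and missing [J'] is
     the required point. *)
  pose G := [set A | Sclosed K A /\ YY `<=` ~` hit congr_family (~` A)].
  pose J' := [set A | Sclosed K A /\ J (~` hit congr_family (~` A))].
  have fG : is_congr_filter G.
    split.
    + by move=> A [].
    + split; first exact: SclosedT.
      by move=> Y _; apply/nhit_congr_family; [exact: SclosedT|split; first exact: SclosedT].
    + move=> A B [SA GA] [SB GB]; have SAB := SclosedI SA SB; split=> // Y YYY.
      apply/nhit_congr_family => //; split=> // x Yx.
      by split; [exact: ((nhit_congr_family Y SA).1 (GA Y YYY)).2
               |exact: ((nhit_congr_family Y SB).1 (GB Y YYY)).2].
    + move=> A B [SA GA] AB; have [_ SB _] := AB; split=> // Y YYY.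
      apply/nhit_congr_family => //; have [_ iY] := congr_familyP Y.
      exact: (congr_filter_up (irr_filter iY) ((nhit_congr_family Y SA).1 (GA Y YYY)) AB).
  have SE (A : set (set_type congr_family)) : Sclosed (hit_subbase K congr_family) A ->
      exists2 B, Sclosed K B & A = ~` hit congr_family (~` B).
    move=> [_ [U KU <-] <-]; exists (~` U); rewrite ?setCK //; exact: Sclosed_setC.
  have [|||A [SA JA] [_ GA]|Q [iQ GQ QJ]] := irreducible_extension (J := J') fG.
  + by have [B SB A0E] := SE _ (JS _ JA0); exists B; split; rewrite -?A0E.
  + by move=> A [].
  + move=> A B [SA JA] [SB JB]; have [H [C [/SE[H' SH ->] JC YH AH BH]]] := JY _ _ JA JB.
    have [C' SC' CE] := SE _ (JS _ JC); subst C.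
    by exists H', C'; split=> //; apply: nhit_congr_le.
  + by have [Y [YYY nA]] := Jne _ JA; apply: nA; exact: GA.
  have [Y YQ] := congr_family_point iQ; exists Y; split.
    move=> A AAA; have [B SB AE] := SE _ (AAS _ AAA); rewrite AE.
    apply/nhit_congr_family => //; rewrite YQ; apply: GQ; split=> //.
    by rewrite -AE => Z; exact.
  move=> A JA; have [B SB AE] := SE _ (JS _ JA); rewrite AE => /(nhit_congr_family Y SB).
  by rewrite YQ; apply: QJ; split; rewrite -?AE.
Qed.

End SemilatticeCongruence.

(** * The relation [R] and its operator [mR] on members of the subbase *)

Section MonotoneVietoris.
Variables (T : choiceType) (K : set (set T)) (R : T -> set (set T)).
Hypothesis hX : mS_space K R.
Implicit Types (A B C U V Y : set T) (F Q J : set (set T)).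

Let hS : S_space K := mS_S_space hX.

Lemma Zfam_subbase U : K U -> Zfam K U.
Proof.
move=> KU; exists [set U]; last by rewrite bigcap_set1.
split; first by move=> _ ->.
by split=> [|_ _ -> ->]; exists U => //; split.
Qed.

(** By [mS_eq], R(x) is an intersection of sets L_U, each closed upwards in [Zfam K]. *)
Lemma rel_up x Z V : R x Z -> K V -> Z `<=` V -> R x V.
Proof.
move=> + KV ZV; rewrite (mS_eq hX) => -[ZZ Zm]; split; first exact: Zfam_subbase.
move=> U Ux; have [_ [y [Zy Uy]]] := Zm U Ux.
by split; [exact: Zfam_subbase|exists y; split=> //; exact: ZV].
Qed.

(** If [U] is not in R(x), then by [rel_up] no member of R(x) is contained in [U], so all of them
    meet its complement. *)
Lemma rel_subbase x U : K U -> R x U <-> ~ mR R (~` U) x.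
Proof.
move=> KU; split=> [RxU mU|nmU]; first by have [y []] := mU _ RxU.
apply: contrapT => nRxU; apply: nmU => Z RxZ; apply: contrapT => ZU.
by apply/nRxU/(rel_up RxZ) => // y Zy; apply: contrapT => nUy; apply: ZU; exists y.
Qed.

Lemma Rimage_subbase Y U : K U -> Rimage K R Y U <-> ~ (Y `<=` mR R (~` U)).
Proof.
move=> KU; split=> [[_ [y [Yy /(rel_subbase y KU) nm]]] Ym|nYm]; first exact/nm/Ym.
split; first exact: Zfam_subbase.
apply: contrapT => noy; apply: nYm => y Yy; apply: contrapT => /(rel_subbase y KU) RyU.
by apply: noy; exists y.
Qed.

Lemma mR_sub A B : A `<=` B -> mR R A `<=` mR R B.
Proof. by move=> AB x mA Z /mA [y [Zy Ay]]; exists y; split=> //; exact: AB. Qed.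

(** * The correspondence between monotone families and congruences *)

Definition vietoris_congr F : set (set T * set T) :=
  [set p | [/\ Sclosed K p.1, Sclosed K p.2 & hit F (~` p.1) = hit F (~` p.2)]].

Lemma hit_subC F A B : hit F (~` A) `<=` hit F (~` B) <->
  forall Y, F Y -> Y `<=` B -> Y `<=` A.
Proof.
split=> [AB Y FY YB|AB Y /hitC nYA].
  apply: contrapT => nYA.
  pose Y' : set_type F := exist (fun Y => Y \in F) _ (mem_set FY).
  by have /AB/hitC : hit F (~` A) Y' by apply/hitC.
by apply/hitC => YB; apply/nYA/AB => //; exact: set_valP.
Qed.

Lemma hit_eqC F A B : hit F (~` A) = hit F (~` B) <->
  forall Y, F Y -> (Y `<=` A <-> Y `<=` B).
Proof.
rewrite eqEsubset; split=> [[/hit_subC AB /hit_subC BA] Y FY|AB].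
  by split; [exact: BA|exact: AB].
by split; apply/hit_subC => Y FY /(AB Y FY).
Qed.

Lemma vietoris_congr_le F A B : Sclosed K A -> Sclosed K B ->
  congr_le K (vietoris_congr F) A B <-> forall Y, F Y -> Y `<=` A -> Y `<=` B.
Proof.
move=> SA SB; split=> [[_ _ [_ _ /hit_eqC AB]] Y FY /(AB Y FY) YAB|AB].
  by apply: (subset_trans YAB); exact: subIsetr.
split=> //; split=> //; first exact: SclosedI.
apply/hit_eqC => Y FY; rewrite subsetI; split=> [[]//|YA].
by split=> //; exact: AB.
Qed.

Lemma vietoris_congr_congruence F : Vm K R F -> is_congruence K R (vietoris_congr F).
Proof.
move=> VF; split.
- by move=> [A B] [].
- by move=> A SA; split.
- by move=> A B [/= SA SB AB]; split.
- by move=> A B C [/= SA SB AB] [_ SC BC]; split=> //=; rewrite AB.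
- move=> A B A' B' [/= SA SB /hit_eqC AB] [/= SA' SB' /hit_eqC AB'].
  split=> /=; [exact: SclosedI|exact: SclosedI|].
  by apply/hit_eqC => Y FY; rewrite !subsetI AB // AB'.
(* If [Y] is not inside [mR R B], the complement of [B] lies in R[Y]. As R[Y] is increasing, the
   complement of [A] does too, so [Y] is not inside [mR R A]. *)
- have mono A B Y : Sclosed K A -> Sclosed K B -> F Y ->
      hit F (~` A) = hit F (~` B) -> Y `<=` mR R A -> Y `<=` mR R B.
    move=> SA SB FY AB YA; apply: contrapT => nYB.
    have [KA KB] := (SclosedC SA, SclosedC SB).
    suff [] : (Rimage K R Y `&` K) (~` A).
      by move=> /(Rimage_subbase _ KA); rewrite setCK.
    rewrite -(mv_increasing VF FY); split=> //; exists (~` B); split; last by rewrite AB.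
    by split=> //; apply/Rimage_subbase; rewrite ?setCK.
  move=> A B [/= SA SB AB]; split=> /=; [exact: (mS_closed hX)|exact: (mS_closed hX)|].
  by apply/hit_eqC => Y FY; split; apply: mono.
Qed.

Lemma congr_family_Vm theta : is_congruence K R theta -> Vm K R (congr_family K theta).
Proof.
move=> cth; split.
- move=> Y [cY iY]; split=> //; have [A SA nYA] := irr_proper iY.
  apply: contrapT => Y0; apply: nYA; split=> // x Yx; exfalso.
  by apply: Y0; exists x.
- exact: congr_family_S_space cth.
- move=> Y [cY iY]; rewrite /hit_increasing eqEsubset; split=> [V|U UY]; last first.
    by split; [exact: UY.2|exists U; split].
  move=> [KV [U [[UY KU]]]] /(hit_congr_family_sub hS cth KU KV) [SV SU VU]; split=> //.
  move/(Rimage_subbase _ KU): UY => nYU; apply/(Rimage_subbase _ KV) => YV.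
  (* Applying [mR] to the congruence of the meet of both complements with that of [V] puts [mR] of
     this meet in the filter of [Y]; by monotonicity [Y] then lies in [mR] of the complement of
     [U]. *)
  have fY := irr_filter iY; have mVU := congr_mR cth VU.
  have [Smi SmV] := congr_sub cth mVU.
  have [] : enclosing K Y (mR R (~` V `&` ~` U)).
    by apply: (congr_filter_up fY (A := mR R (~` V))) => //;
      exact: (congr_leP cth (congr_sym cth mVU)).
  by move=> _ h; apply/nYU/(subset_trans h)/mR_sub; exact: subIsetr.
Qed.

Lemma congr_familyK theta : is_congruence K R theta ->
  vietoris_congr (congr_family K theta) = theta.
Proof.
move=> cth; rewrite eqEsubset; split=> -[A B] => [[/= SA SB]|AB].
  have [KA KB] := (SclosedC SA, SclosedC SB).
  rewrite eqEsubset => -[/(hit_congr_family_sub hS cth KA KB) + ].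
  move=> + /(hit_congr_family_sub hS cth KB KA); rewrite !setCK => BA AB.
  exact: (congr_le_anti cth).
have [/= SA SB] := congr_sub cth AB; split=> //=.
have [KA KB] := (SclosedC SA, SclosedC SB).
rewrite eqEsubset; split; apply/(hit_congr_family_sub hS cth) => //; rewrite !setCK.
  exact: (congr_leP cth (congr_sym cth AB)).
exact: (congr_leP cth AB).
Qed.

Lemma enclosing_irreducible F Y : Vm K R F -> F Y ->
  is_irreducible K (vietoris_congr F) (enclosing K Y).
Proof.
move=> VF FY; have SF := mv_S_space VF.
pose Y' : set_type F := exist (fun Y => Y \in F) _ (mem_set FY).
split.
- split.
  + by move=> A [].
  + by split; first exact: SclosedT.
  + by move=> A B [SA YA] [SB YB]; split; [exact: SclosedI|rewrite subsetI].
  + move=> A B [SA YA] AB; have [_ SB _] := AB; split=> //.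
    by move/(vietoris_congr_le F SA SB): AB; apply.
- have : (\bigcup_(U in hit_subbase K F) U) Y' by rewrite (S1_cover SF).
  move=> [_ [U KU <-] /hitNC nYU]; exists (~` U); first exact: Sclosed_setC.
  by move=> [].
- move=> A B SA SB nYA nYB.
  (* (S3) at the point [Y] yields the splitting: the complements of [U] and [V] serve as [H] and
     [C]. *)
  have [|||W [D [[U KU <-] [V KV <-] nW hD sub]]] :=
    S3 SF (U := hit F (~` A)) (V := hit F (~` B)) (x := Y').
  + by exists (~` A) => //; exact: SclosedC.
  + by exists (~` B) => //; exact: SclosedC.
  + by split; apply/hitC => YA; [apply: nYA|apply: nYB].
  have [SU SV] := (Sclosed_setC KU, Sclosed_setC KV).
  exists (~` U), (~` V); split=> //.
  + by split=> //; apply: contrapT => /(hitNC U Y').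
  + by move=> [_]; move/hitNC: hD.
  + apply/vietoris_congr_le => //; first exact: SclosedI.
    move=> Z FZ; rewrite subsetI => -[ZA ZU]; apply: contrapT => nZV.
    pose Z' : set_type F := exist (fun Y => Y \in F) _ (mem_set FZ).
    have /sub : hit F V Z' by apply/hitNC.
    by move=> [[/hitC + _]|/hitNC]; exact.
  + apply/vietoris_congr_le => //; first exact: SclosedI.
    move=> Z FZ; rewrite subsetI => -[ZB ZU]; apply: contrapT => nZV.
    pose Z' : set_type F := exist (fun Y => Y \in F) _ (mem_set FZ).
    have /sub : hit F V Z' by apply/hitNC.
    by move=> [[_ /hitC]|/hitNC]; exact.
Qed.

Lemma irreducible_enclosing F Q : Vm K R F ->
  is_irreducible K (vietoris_congr F) Q -> exists2 Y, F Y & enclosing K Y = Q.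
Proof.
move=> VF iQ; have SF := mv_S_space VF; have fQ := irr_filter iQ.
pose c A := ~` hit F (~` A).
have cP A (Y : set_type F) : c A Y <-> val Y `<=` A.
  split=> [nh|YA /hitC]; last exact.
  by apply: contrapT => nYA; apply: nh; apply/hitC.
have Sc A : Sclosed K A -> Sclosed (hit_subbase K F) (c A).
  by move=> SA; apply: Sclosed_setC; exists (~` A) => //; exact: SclosedC.
have cQS : c @` Q `<=` Sclosed (hit_subbase K F).
  by move=> _ [A QA <-]; apply: Sc; exact: (congr_filter_sub fQ QA).
(* The closed set consists of the members of [F] inside every set of [Q]; the Y-family comes from
   the sets outside [Q], directed by [irr_split]. A point given by (S4) has trace exactly [Q]. *)
have [||B' [B [SB nQB] <-]|Y [YQ YnQ]] := S4 SF (Y := \bigcap_(A in c @` Q) A)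
    (J := c @` [set B | Sclosed K B /\ ~ Q B]).
- exact: subbasic_closed_bigcap.
- split.
  + by have [B SB nQB] := irr_proper iQ; exists (c B), B.
  + by move=> _ [B [SB _] <-]; exact: Sc.
  + move=> _ _ [A [SA nQA] <-] [B [SB nQB] <-].
    have [H [C [QH SC nQC AC BC]]] := irr_split iQ SA SB nQA nQB.
    have SH := congr_filter_sub fQ QH.
    exists (c H), (c C); split.
    * exact: Sc.
    * by exists C.
    * by move=> Y; apply; exists H.
    * move=> Y [/cP YA /cP YH]; apply/cP.
      move/vietoris_congr_le: AC; apply => //; first exact: SclosedI.
        exact: set_valP.
      by rewrite subsetI.
    * move=> Y [/cP YA /cP YH]; apply/cP.
      move/vietoris_congr_le: BC; apply => //; first exact: SclosedI.
        exact: set_valP.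
      by rewrite subsetI.
(* If every point of the closed set lay inside [B], compactness would give [A] in [Q] such that all
   members of [F] inside [A] are inside [B]; then [B] would be in [Q]. *)
- apply: contrapT => noY.
  have [|||||A' [A QA <-] AB] := bigcap_Sclosed_sub SF (Q := c @` Q) (A := c B).
  + by exists (c setT), setT => //; exact: (congr_filterT fQ).
  + exact: cQS.
  + move=> _ _ [A QA <-] [D QD <-]; exists (A `&` D); first exact: (congr_filterI fQ).
    rewrite predeqE => Y; split=> [/cP|[/cP YA /cP YD]]; last by apply/cP; rewrite subsetI.
    by rewrite subsetI => -[YA YD]; split; apply/cP.
  + exact: Sc.
  + by move=> Y YQ; apply: contrapT => nY; apply: noY; exists Y.
  apply: nQB; apply: (congr_filter_up fQ QA); apply/vietoris_congr_le => //.
    exact: (congr_filter_sub fQ QA).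
  move=> Y FY YA.
  pose Y' : set_type F := exist (fun Y => Y \in F) _ (mem_set FY).
  by have /AB/cP : c A Y' by apply/cP.
exists (val Y); first exact: set_valP.
rewrite eqEsubset; split=> [A [SA YA]|A QA].
  by apply: contrapT => nQA; apply: (YnQ (c A)); [exists A|apply/cP].
by split; [exact: (congr_filter_sub fQ QA)|apply/cP; apply: YQ; exists A].
Qed.

(** Both families consist of subbasic closed sets, which their traces determine, and in both the
    traces are exactly the irreducible filters. *)
Lemma vietoris_congrK F : Vm K R F -> congr_family K (vietoris_congr F) = F.
Proof.
move=> VF; rewrite eqEsubset; split=> [Y [cY iY]|Y FY].
  have [Y' FY' YY'] := irreducible_enclosing VF iY.
  by have [cY' _] := mv_closed VF FY'; rewrite -(enclosing_inj cY' cY YY').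
by split; [exact: (mv_closed VF FY).1|exact: enclosing_irreducible].
Qed.

Lemma vietoris_congr_bij : set_bij (Vm K R) (congruences K R) vietoris_congr.
Proof.
split.
- by move=> F; exact: vietoris_congr_congruence.
- move=> F F'; rewrite !inE => VF VF' FF'.
  by rewrite -(vietoris_congrK VF) FF' vietoris_congrK.
- move=> theta cth; exists (congr_family K theta); first exact: congr_family_Vm.
  exact: congr_familyK.
Qed.

Lemma vietoris_leE F F' :
  vietoris_le K F F' <-> vietoris_congr F' `<=` vietoris_congr F.
Proof.
split=> [FF' [A B] [/= SA SB AB]|FF' U V KU KV UV].
  by split=> //=; apply: FF' => //; exact: SclosedC.
have [|/= _ _] := FF' (~` U, ~` V); last by rewrite !setCK.
by split=> /=; rewrite ?setCK //; exact: Sclosed_setC.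
Qed.

Lemma congruences_inf (B : set (set (set T * set T))) : B `<=` congruences K R ->
  exists i, is_infimum subset (congruences K R) B i.
Proof.
(* The first factor makes the infimum of the empty family the total congruence on S(X). *)
move=> BC; exists (Sclosed K `*` Sclosed K `&` \bigcap_(theta in B) theta).
split=> [|theta Btheta p [_ Bp]|theta ctheta lb p tp]; last 2 first.
- exact: Bp.
- by split; [exact: (congr_sub ctheta)|move=> psi Bpsi; exact: lb tp].
split.
- by move=> p [].
- by move=> A SA; split=> // theta /BC cth; exact: (congr_refl cth).
- move=> A A' [[SA SA'] AA']; split=> // theta Bt.
  exact: (congr_sym (BC _ Bt) (AA' _ Bt)).
- move=> A A' A'' [[SA SA'] AA'] [[_ SA''] AA'']; split=> // theta Bt.
  exact: (congr_trans (BC _ Bt) (AA' _ Bt) (AA'' _ Bt)).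
- move=> A1 A2 A3 A4 [[/= S1 S2] A12] [[/= S3 S4] A34]; split.
    by split; exact: SclosedI.
  by move=> theta Bt; exact: (congr_meet (BC _ Bt) (A12 _ Bt) (A34 _ Bt)).
- move=> A A' [[/= SA SA'] AA']; split; first by split; exact: (mS_closed hX).
  by move=> theta Bt; exact: (congr_mR (BC _ Bt) (AA' _ Bt)).
Qed.

End MonotoneVietoris.

Theorem theorem23 (T : choiceType) (K : set (set T)) (R : T -> set (set T))
    (hX : mS_space K R) :
  is_complete_lattice (vietoris_le K) (Vm K R) /\
  dually_isomorphic (vietoris_le K) (Vm K R)
    (fun theta1 theta2 : set (set T * set T) => theta1 `<=` theta2)
    (congruences K R).
Proof.
split.
  apply: is_complete_lattice_dual_iso (vietoris_congr_bij hX) _ (congruences_inf hX).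
  by move=> F F' _ _; exact: vietoris_leE.
exists (vietoris_congr K); split; first exact: vietoris_congr_bij.
by move=> F F' _ _; exact: vietoris_leE.
Qed.
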